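(* For every integer $d\geq 1$ there exist three real symmetric $d\times d$ matrices $C_0,C_1,C_2$ such that there are exactly $\binom{d+1}{3}$ pairs of complex numbers $(x,y)$ for which the matrix $C_0+xC_1+yC_2$ has a critical double eigenvalue, and all of these $\binom{d+1}{3}$ pairs are real (i.e. $(x,y)\in\mathbb{R}^2$).
   Context: A complex symmetric $d\times d$ matrix $C$ is said to have a critical double eigenvalue if it lies in the Zariski closure (in the space of complex symmetric $d\times d$ matrices) of the set of real symmetric $d\times d$ matrices having a repeated eigenvalue; equivalently, if there exists $\lambda\in\mathbb{C}$ with $\mathrm{rank}(C-\lambda I)\le d-2$. This is a variety of codimension $2$ and degree $\binom{d+1}{3}$. *)

(* Defs.v *)
From HB Require Import structures.
From mathcomp Require Import all_boot all_order all_algebra.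
From mathcomp Require Import reals complex mpoly.

Set Implicit Arguments.
Unset Strict Implicit.
Unset Printing Implicit Defensive.

Import GRing.Theory Num.Theory.
Local Open Scope ring_scope.

Definition has_repeated_eigenvalue (R : realType) (d : nat) (A : 'M[R]_d) : Prop :=
  exists lambda : R, (2 <= mup lambda (char_poly A))%N.

(* A polynomial function of a matrix is a polynomial in its d * d entries. Every
   polynomial function on the linear subspace of symmetric matrices is the
   restriction of one of these, so for a set of symmetric matrices the closure
   taken here is the Zariski closure in the space of symmetric matrices. *)
Definition zariski_closure (K : fieldType) (d : nat) (S : 'M[K]_d -> Prop)
    (M : 'M[K]_d) : Prop :=
  forall p : {mpoly K[d * d]},
    (forall A : 'M[K]_d, S A -> p.@[mxvec A 0] = 0) -> p.@[mxvec M 0] = 0.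

Definition real_sym_repeated (R : realType) (d : nat) (M : 'M[R[i]]_d) : Prop :=
  exists A : 'M[R]_d,
    [/\ A^T = A, has_repeated_eigenvalue A & M = map_mx (real_complex R) A].

Definition critical_double_eigenvalue (R : realType) (d : nat)
    (M : 'M[R[i]]_d) : Prop :=
  M^T = M /\ zariski_closure (@real_sym_repeated R d) M.

(* Main.v *)
(* Let J be the all-ones matrix, let D(x, y) be the diagonal matrix with entries
   m_i = t_i^2 + x t_i + y t_i^3, where t_i = 2^i, and take the net D(x, y) + y J.
   The matrix D(x, y) + y J - l has corank at least 2 exactly when three of the
   d + 1 affine forms y, m_1 - l, ..., m_d - l vanish.  Three forms m_i - l vanish
   when the cubic y t^3 + t^2 + x t - l is y (t - t_i) (t - t_j) (t - t_k), and
   y = m_i - l = m_j - l = 0 when t^2 + x t - l is (t - t_i) (t - t_j); so there is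
   one solution, a real one, for each 3-subset of the d + 1 forms.  The solutions
   are distinct because sums of distinct powers of 2 determine their summands.

   On the Zariski closure of the real symmetric matrices with a repeated
   eigenvalue, the powers I, M, ..., M^(d-1) remain linearly dependent, so M is
   annihilated by a nonzero polynomial of degree less than d; since corank is
   subadditive along its linear factors, some M - l has corank at least 2. *)

Require Import Defs.
From HB Require Import structures.
From mathcomp Require Import all_boot all_order all_algebra.
From mathcomp Require Import reals complex.
From mathcomp Require Import mpoly ring zify.

Set Implicit Arguments.
Unset Strict Implicit.
Unset Printing Implicit Defensive.

Import GRing.Theory Num.Theory.
Local Open Scope ring_scope.

(** * Uniqueness of binary expansions *)

Lemma sum_pow2_inj (d : nat) (b c : 'I_d -> bool) :
  (\sum_(i < d) b i * 2 ^ i = \sum_(i < d) c i * 2 ^ i)%N -> b =1 c.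
Proof.
elim: d b c => [|d IH] b c; first by move=> _ [].
have E (f : 'I_d.+1 -> bool) : (\sum_(i < d.+1) f i * 2 ^ i =
    f ord0 + (\sum_(i < d) f (lift ord0 i) * 2 ^ i).*2)%N.
  rewrite big_ord_recl /= expn0 muln1 -muln2 big_distrl /=; congr addn.
  by apply: eq_bigr => i _; rewrite /bump /= add1n expnSr mulnA.
rewrite !E => eq_bc.
(* Parity reads off the lowest bit; halving leaves the others to the induction. *)
have bc0 : b ord0 = c ord0.
  by have := congr1 odd eq_bc; rewrite !oddD !odd_double !addbF !oddb.
have {}IH : (fun i => b (lift ord0 i)) =1 (fun i => c (lift ord0 i)).
  by apply: IH; apply: double_inj; move: eq_bc; rewrite bc0 => /addnI.
by move=> i; case: (unliftP ord0 i) => [j|] ->; [apply: IH | apply: bc0].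
Qed.

Lemma subset_sum_pow2_inj (d : nat) :
  injective (fun A : {set 'I_d} => \sum_(i in A) 2 ^ i)%N.
Proof.
move=> A B /= eq_AB; apply/setP.
apply: (@sum_pow2_inj d (fun i => i \in A) (fun i => i \in B)) => /=.
have E (C : {set 'I_d}) :
    (\sum_(i < d) (i \in C) * 2 ^ i = \sum_(i in C) 2 ^ i)%N.
  by rewrite [RHS]big_mkcond; apply: eq_bigr => i _; case: (i \in C); rewrite ?mul1n.
by rewrite !E.
Qed.

(** * Repeated eigenvalues from left eigenvectors *)

(** Each Leibniz term has one factor from row [i] and one from row [j]. *)
Lemma dvdp_det_two_rows (F : fieldType) (n : nat) (N : 'M[{poly F}]_n)
    (q : {poly F}) (i j : 'I_n) :
  i != j -> (forall k, q %| N i k) -> (forall k, q %| N j k) -> q ^+ 2 %| \det N.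
Proof.
move=> ij qi qj; apply: (big_ind (fun p => q ^+ 2 %| p)) => [|p1 p2|/= s _].
- exact: dvdp0.
- exact: dvdp_add.
apply: dvdp_mull.
rewrite (bigD1 i) // (bigD1 j) 1?eq_sym //= mulrA expr2.
by apply: dvdp_mulr; apply: dvdp_mul.
Qed.

(** Rows [i] and [j] of [P (X - A)] are multiples of [X - l], and [\det P] is a nonzero constant. *)
Lemma mup_char_poly_ge2 (F : fieldType) (n : nat) (A P : 'M[F]_n) (l : F)
    (i j : 'I_n) :
  i != j -> P \in unitmx ->
  row i (P *m A) = l *: row i P -> row j (P *m A) = l *: row j P ->
  (2 <= mup l (char_poly A))%N.
Proof.
move=> ij uP Ei Ej.
rewrite mup_geq ?monic_neq0 ?char_poly_monic //.
have E : map_mx polyC P *m char_poly_mx A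
    = 'X *: map_mx polyC P - map_mx polyC (P *m A).
  by rewrite mulmxBr mul_mx_scalar map_mxM.
have row_dvd k : row k (P *m A) = l *: row k P ->
    forall m, 'X - l%:P %| (map_mx polyC P *m char_poly_mx A) k m.
  move=> /rowP Ek m; have := Ek m; rewrite E !mxE => ->.
  by rewrite polyCM -mulrBl dvdp_mulr.
have := dvdp_det_two_rows ij (row_dvd _ Ei) (row_dvd _ Ej).
rewrite det_mulmx det_map_mx mul_polyC dvdpZr //.
by rewrite -unitfE -unitmxE.
Qed.

(** * Linear dependence of matrix powers and the Zariski closure *)

(** The diagonal entries of [B^T B] are the sums of squares of the columns of [B]. *)
Lemma mulmx_trmx_eq0 (F : realDomainType) (m n : nat) (B : 'M[F]_(m, n)) :
  B^T *m B = 0 -> B = 0.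
Proof.
move=> E; apply/matrixP=> i j; rewrite mxE.
have /matrixP/(_ j j) := E; rewrite !mxE => /psumr_eq0P H.
have := H _ i isT; rewrite mxE => /(_ _)/eqP.
rewrite -expr2 sqrf_eq0 => H'; apply/eqP; apply: H' => k _.
by rewrite mxE -expr2 sqr_ge0.
Qed.

(* A symmetric [B] with [B ^ 2 Q = 0] satisfies [(B Q)^T (B Q) = 0], so the
   double root of the characteristic polynomial can be made simple. *)
Lemma powers_mx_sym_repeated (R : realType) (n : nat) (A : 'M[R]_n.+1) :
  A^T = A -> has_repeated_eigenvalue A -> ~~ row_free (powers_mx A n.+1).
Proof.
move=> symA [l]; have p0 := monic_neq0 (char_poly_monic A).
rewrite mup_geq // => /dvdpP [q Eq].
have q0 : q != 0 by apply: contraNneq p0 => q0; rewrite Eq q0 mul0r.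
pose Q := horner_mx A q; pose B := A - l%:M.
have EB : horner_mx A ('X - l%:P) = B by rewrite rmorphB /= horner_mx_X horner_mx_C.
have E0 : B *m (B *m Q) = 0.
  have := Cayley_Hamilton A; rewrite Eq mulrC rmorphM rmorphXn /= EB expr2.
  by rewrite -mulrA.
have BQ : B *m Q = 0.
  apply: mulmx_trmx_eq0; rewrite trmx_mul -mulmxA.
  have -> : B^T = B by rewrite linearB /= symA tr_scalar_mx.
  by rewrite E0 mulmx0.
(* The characteristic polynomial with one factor [X - l] removed still kills [A]. Its degree is at
   most [n], so its coefficients are a linear relation among the first [n.+1] powers. *)
pose p := ('X - l%:P) * q.
have sp : (size p <= n.+1)%N.
  have := congr1 (fun p : {poly R} => size p) Eq.
  rewrite /= size_char_poly mulrC size_monicM ?monic_exp ?monicXsubC //.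
  rewrite size_exp_XsubC /= /p size_monicM ?monicXsubC // size_XsubC /=.
  by rewrite -(size_poly_gt0 q) in q0 *; lia.
apply/negP => /row_free_inj inj.
have : poly_rV p *m powers_mx A n.+1 = 0 *m powers_mx A n.+1 :> 'rV_(n.+1 * n.+1).
  apply: (can_inj (@vec_mxK _ _ _)); rewrite mul0mx linear0 -horner_rVpoly.
  by rewrite poly_rV_K // rmorphM /= EB.
move=> /inj /(congr1 rVpoly); rewrite poly_rV_K // linear0 => /eqP.
by rewrite mulf_eq0 (negPf q0) polyXsubC_eq0.
Qed.

(** Independence of the powers of [M] is witnessed by a nonzero maximal minor of [powers_mx]. The
    same minor is polynomial in the matrix entries and vanishes on [S], hence at [M]. *)
Lemma powers_mx_zariski_closure (K : fieldType) (n : nat)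
    (S : 'M[K]_n.+1 -> Prop) (M : 'M[K]_n.+1) :
  (forall A, S A -> ~~ row_free (powers_mx A n.+1)) ->
  zariski_closure S M -> ~~ row_free (powers_mx M n.+1).
Proof.
move=> SN clM; apply/negP => freeM.
have fullM : row_full (powers_mx M n.+1)^T by rewrite /row_full mxrank_tr.
pose f := fullrankfun fullM.
(* The generic matrix, whose entries are the variables; evaluating its minor at [A] gives that minor
   for [A]. *)
pose X : 'M[{mpoly K[n.+1 * n.+1]}]_n.+1 := vec_mx (\row_j 'X_j).
pose p := \det (rowsub f (powers_mx X n.+1)^T).
have pE (A : 'M[K]_n.+1) :
    p.@[mxvec A 0] = \det (rowsub f (powers_mx A n.+1)^T).
  rewrite -det_map_mx map_mxsub -matrix.map_trmx map_powers_mx.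
  suff -> : map_mx (meval (mxvec A 0)) X = A by [].
  rewrite map_vec_mx -[RHS]mxvecK; congr vec_mx; apply/rowP => j.
  by rewrite !mxE mevalXU.
have : p.@[mxvec M 0] = 0.
  apply: clM => A /SN nfree; rewrite pE; apply/eqP; apply: contraNT nfree.
  rewrite -unitfE -unitmxE -row_free_unit => /eqP rk.
  rewrite /row_free eqn_leq rank_leq_row -mxrank_tr -{1}rk.
  by rewrite -[X in rowsub f X]mul1mx -mul_rowsub_mx mxrankM_maxr.
apply/eqP; rewrite pE -unitfE -unitmxE.
exact: fullrowsub_unit.
Qed.

(** Each linear factor has corank at most 1, and corank is subadditive under products. *)
Lemma mxrank_prod_ge (F : fieldType) (n : nat) (M : 'M[F]_n.+1) (rs : seq F) :
  {in rs, forall l, (n <= \rank (M - l%:M)%R)%N} ->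
  (n.+1 - size rs <= \rank (horner_mx M (\prod_(z <- rs) ('X - z%:P))))%N.
Proof.
elim: rs => [_|z rs IH hM].
  by rewrite big_nil rmorph1 mxrank1.
rewrite big_cons rmorphM rmorphB /= horner_mx_X horner_mx_C.
have rkz := hM z (mem_head _ _).
have rkrs : (n.+1 - size rs <= \rank (horner_mx M (\prod_(z <- rs) ('X - z%:P))))%N.
  by apply: IH => l l_rs; apply: hM; rewrite inE l_rs orbT.
apply: leq_trans (mxrank_mul_min _ _).
by apply: leq_trans (leq_sub2r n.+1 (leq_add rkz rkrs)); lia.
Qed.

(** For size [n.+1], rank below [n] means corank at least 2. Otherwise the annihilating polynomial,
    with at most [n] linear factors, would take a value of rank at least 1. *)
Lemma eigenvalue_corank2 (F : closedFieldType) (n : nat) (M : 'M[F]_n.+1) :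
  ~~ row_free (powers_mx M n.+1) -> exists l, (\rank (M - l%:M)%R < n)%N.
Proof.
move=> nfree.
have [u u0 uM] : exists2 u : 'rV_n.+1, u != 0 & u *m powers_mx M n.+1 = 0.
  have /rowV0Pn[u /sub_kermxP uM u0] : kermx (powers_mx M n.+1) != 0.
    by rewrite kermx_eq0.
  by exists u.
pose p := rVpoly u.
have p0 : p != 0 by rewrite -(inj_eq (can_inj (@rVpolyK _ _))) linear0 in u0.
have pM : horner_mx M p = 0 by rewrite horner_rVpoly uM linear0.
have [rs Ep] := closed_field_poly_normal p.
have sz : (size rs < n.+1)%N.
  have : (size p <= n.+1)%N by rewrite size_poly.
  by rewrite Ep size_scale ?lead_coef_eq0 // size_prod_XsubC.
have : horner_mx M (\prod_(z <- rs) ('X - z%:P)) = 0.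
  move: pM; rewrite Ep linearZ /= => /eqP.
  by rewrite scaler_eq0 lead_coef_eq0 (negPf p0) => /eqP.
move=> /(congr1 mxrank); rewrite mxrank0 => rk.
have [/hasP[l _ lt]|/hasPn le] := boolP (has (fun l => \rank (M - l%:M)%R < n)%N rs).
  by exists l.
have := mxrank_prod_ge (M := M) (rs := rs); rewrite rk.
suff le' : {in rs, forall l, (n <= \rank (M - l%:M)%R)%N}
  by move/(_ le'); rewrite leqn0 subn_eq0 leqNgt sz.
by move=> l /le; rewrite -leqNgt.
Qed.

(** * Corank of a diagonal matrix plus a multiple of the all-ones matrix *)

(** The left kernel has dimension at least 2, so one linear condition leaves a nonzero vector in
    it. *)
Lemma ker_in_hyperplane (F : fieldType) (n : nat) (N : 'M[F]_n.+1)
    (f : 'cV[F]_n.+1) :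
  (\rank N < n)%N -> exists v : 'rV_n.+1, [/\ v != 0, v *m N = 0 & v *m f = 0].
Proof.
move=> rkN.
have : kermx (row_mx N f) != 0.
  rewrite kermx_eq0 /row_free neq_ltn; apply/orP; left.
  rewrite -mxrank_tr tr_row_mx -addsmxE.
  apply: leq_ltn_trans (mxrank_adds_leqif _ _) _.
  by rewrite !mxrank_tr (leq_trans (leq_add rkN (rank_leq_col f))) ?addn1.
move=> /rowV0Pn[v /sub_kermxP vN v0]; exists v.
by move: vN; rewrite mul_mx_row -[0]row_mx0 => /eq_row_mx[].
Qed.

Definition diag_plus_J (F : pzRingType) (n : nat) (m : 'I_n -> F) (y : F) : 'M_n :=
  diag_mx (\row_i m i) + y *: const_mx 1.

Lemma mul_diag_plus_J (F : comPzRingType) (n : nat) (m : 'I_n -> F) (y : F)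
    (v : 'rV_n) i :
  (v *m diag_plus_J m y) 0 i = m i * v 0 i + y * \sum_j v 0 j.
Proof.
rewrite mulmxDr -scalemxAr mul_mx_diag !mxE mulrC; congr (_ + _ * _).
by apply: eq_bigr => j _; rewrite mxE mulr1.
Qed.

Lemma sum_row_eq0_neq (F : pzRingType) (n : nat) (v : 'rV[F]_n) (j : 'I_n) :
  \sum_i v 0 i = 0 -> v 0 j != 0 -> exists2 k, k != j & v 0 k != 0.
Proof.
move=> sv vj; have [k /andP[]|H] := pickP (fun k => (k != j) && (v 0 k != 0)).
  by exists k.
move: sv; rewrite (bigD1 j) //= big1 ?addr0 => [vj0|k kj].
  by rewrite vj0 eqxx in vj.
by have := H k; rewrite kj => /negbFE/eqP.
Qed.

Lemma diag_plus_J_corank2 (F : fieldType) (n : nat) (m : 'I_n.+1 -> F) (y l : F) :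
  (\rank (diag_plus_J m y - l%:M)%R < n)%N ->
  exists j k, [/\ j != k, m j = l, m k = l &
    y = 0 \/ exists i, [/\ i != j, i != k & m i = l]].
Proof.
set N := _ - _ => rkN.
have NE : N = diag_plus_J (fun i => m i - l) y.
  rewrite /N /diag_plus_J addrAC; congr (_ + _); apply/matrixP => i j.
  by rewrite !mxE; case: eqP => _; rewrite ?mulr1n // !mulr0n subr0.
have zeros (v : 'rV_n.+1) : v != 0 -> v *m N = 0 -> \sum_i v 0 i = 0 ->
    exists j k, [/\ j != k, v 0 j != 0, v 0 k != 0, m j = l & m k = l].
  move=> v0 vN sv.
  have ml i : v 0 i != 0 -> m i = l.
    move=> vi; have /rowP/(_ i) := vN; rewrite NE mul_diag_plus_J sv mulr0 addr0.
    by rewrite mxE => /eqP; rewrite mulf_eq0 (negPf vi) orbF subr_eq0 => /eqP.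
  have /rV0Pn[j vj] := v0; have [k kj vk] := sum_row_eq0_neq sv vj.
  by exists j, k; rewrite eq_sym !ml.
(* Both kernel vectors below have zero sum, so each has two nonzero coordinates,
   which sit at zeros of [m - l]; the second vector avoids the zero [i]. *)
have [v [v0 vN vs]] := ker_in_hyperplane (const_mx 1) rkN.
have sv : \sum_i v 0 i = 0.
  by move/rowP/(_ 0): vs; rewrite !mxE => {2}<-; apply: eq_bigr => i _; rewrite mxE mulr1.
have [i [k0 [ik0 vi vk mi mk]]] := zeros v v0 vN sv.
have [y0|y0] := eqVneq y 0; first by exists i, k0; split=> //; left.
have [w [w0 wN wi]] := ker_in_hyperplane (delta_mx i 0) rkN.
have {}wi : w 0 i = 0.
  by rewrite -colE in wi; move/colP/(_ 0): wi; rewrite !mxE.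
(* As [w] vanishes at [i], coordinate [i] of the kernel equation reduces to [y] times the sum of
   [w], with [y] nonzero. *)
have sw : \sum_j w 0 j = 0.
  have /rowP/(_ i) := wN; rewrite NE mul_diag_plus_J wi mulr0 add0r mxE.
  by move/eqP; rewrite mulf_eq0 (negPf y0) => /eqP.
have [j [k [jk wj wk mj mk']]] := zeros w w0 wN sw.
exists j, k; split=> //; right; exists i; split=> //.
  by apply: contraNneq wj => <-; rewrite wi.
by apply: contraNneq wk => <-; rewrite wi.
Qed.

Lemma diag_plus_J_repeated (R : realType) (n : nat) (m : 'I_n -> R) (y l : R) j k :
  j != k -> m j = l -> m k = l ->
  y = 0 \/ (exists i, [/\ i != j, i != k & m i = l]) ->
  has_repeated_eigenvalue (diag_plus_J m y).
Proof.
move=> jk mj mk H; exists l.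
(* The all-ones term drops out when [y] or the row sum is zero; the diagonal part acts as [l] on a
   row supported where [m] equals [l]. *)
have row_eig (P : 'M_n) a : y * \sum_b P a b = 0 -> (forall b, m b * P a b = l * P a b) ->
    row a (P *m diag_plus_J m y) = l *: row a P.
  move=> sP mP; rewrite row_mul; apply/rowP => b.
  rewrite mul_diag_plus_J !mxE mP; under eq_bigr do rewrite mxE.
  by rewrite sP addr0.
case: H => [y0|[i [ij ik mi]]].
  apply: (@mup_char_poly_ge2 _ _ _ 1%:M l j k) => //; first exact: unitmx1.
    apply: row_eig => [|b]; rewrite ?y0 ?mul0r // !mxE.
    by case: eqP => [<-|]; rewrite ?mj ?mulr0.
  apply: row_eig => [|b]; rewrite ?y0 ?mul0r // !mxE.
  by case: eqP => [<-|]; rewrite ?mk ?mulr0.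
(* Rows [j] and [k] minus row [i] are left eigenvectors. *)
pose D : 'M[R]_n := delta_mx j i + delta_mx k i.
have D2 : D *m D = 0.
  by rewrite mulmxDl !mulmxDr !mul_delta_mx_0 ?addr0 // eq_sym.
have uP : 1%:M - D \in unitmx.
  suff /mulmx1_unit[] : (1%:M - D) *m (1%:M + D) = 1%:M by [].
  by rewrite mulmxDr mulmx1 mulmxBl mul1mx D2 subr0 subrK.
have rowP a : (a == j) || (a == k) -> m a = l ->
    row a ((1%:M - D) *m diag_plus_J m y) = l *: row a (1%:M - D).
  move=> ajk ma.
  have E b : (1%:M - D) a b = (b == a)%:R - (b == i)%:R.
    rewrite !mxE eq_sym; congr (_ - _); case/orP: ajk => /eqP ->; rewrite eqxx /=.
      by rewrite (negPf jk) addr0.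
    by rewrite eq_sym (negPf jk) add0r.
  apply: row_eig => [|b].
    under eq_bigr do rewrite E.
    rewrite sumrB; have S c : \sum_(b < n) (b == c)%:R = 1 :> R.
      by rewrite (bigD1 c) //= eqxx big1 ?addr0 // => b /negPf ->.
    by rewrite !S subrr mulr0.
  rewrite E; case: (eqVneq b a) => [->|_]; first by rewrite ma.
  by case: (eqVneq b i) => [->|_]; rewrite ?mi // subrr !mulr0.
by apply: (mup_char_poly_ge2 jk uP); apply: rowP; rewrite ?eqxx ?orbT.
Qed.

(** * The net and its solutions *)

Definition net_diag (K : pzRingType) (x y t : K) : K := t ^+ 2 + x * t + y * t ^+ 3.

(** Stated over any ring so that the real and complex nets are compared through [map_net]. *)
Definition net (K : pzRingType) (d : nat) (x y : K) : 'M[K]_d :=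
  diag_plus_J (fun i => net_diag x y (2 ^ i)%:R) y.

Lemma map_net (K L : pzRingType) (f : {rmorphism K -> L}) (d : nat) (x y : K) :
  map_mx f (net d x y) = net d (f x) (f y).
Proof.
apply/matrixP => i j; rewrite !mxE rmorphD rmorphMn rmorphM rmorph1 /net_diag.
by rewrite !(rmorphD, rmorphM, rmorphXn, rmorph_nat) /=.
Qed.

Lemma tr_net (K : pzRingType) (d : nat) (x y : K) : (net d x y)^T = net d x y.
Proof. by rewrite linearD linearZ /= tr_diag_mx trmx_const. Qed.

(* The first case is the solution on the line y = 0; in the second one,
   (e1 ^ 2 - p2) / 2 is the second elementary symmetric function. *)
Definition node (K : fieldType) (d : nat) (A : {set 'I_d}) : K * K :=
  let e1 := \sum_(i in A) (2 ^ i)%:R in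
  let p2 := \sum_(i in A) (2 ^ i)%:R ^+ 2 in
  if #|A| == 2 then (- e1, 0) else (- ((e1 ^+ 2 - p2) / 2) / e1, - e1^-1).

(** These index the 3-subsets of the [d + 1] forms: a pair stands for a 3-subset containing the form
    [y]. The count below is then Pascal's rule. *)
Definition pairs_and_triples (d : nat) : {set {set 'I_d}} :=
  [set A : {set 'I_d} | (#|A| == 2) || (#|A| == 3)].

Lemma card_pairs_and_triples (d : nat) : #|pairs_and_triples d| = 'C(d.+1, 3).
Proof.
have -> : pairs_and_triples d =
    [set A : {set 'I_d} | #|A| == 3] :|: [set A : {set 'I_d} | #|A| == 2].
  by apply/setP => A; rewrite !inE orbC.
rewrite cardsU !card_draws card_ord binS.
rewrite (_ : _ :&: _ = set0) ?cards0 ?subn0 //.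
by apply/setP => A; rewrite !inE; case: eqP => // ->.
Qed.

Lemma sum_pow2_neq0 (K : numFieldType) (d : nat) (A : {set 'I_d}) :
  (0 < #|A|)%N -> \sum_(i in A) (2 ^ i)%:R != 0 :> K.
Proof.
rewrite card_gt0 => /set0Pn[i iA].
by rewrite -natr_sum pnatr_eq0 (bigD1 i) //= addn_eq0 expn_eq0.
Qed.

(** The second coordinate is zero exactly for pairs. The first coordinate of a pair and the second
    of a triple determine [e1], hence the subset. *)
Lemma node_inj (K : numFieldType) (d : nat) :
  {in pairs_and_triples d &, injective (@node K d)}.
Proof.
move=> A B; rewrite !inE => cA cB.
have e1A : \sum_(i in A) (2 ^ i)%:R != 0 :> K.
  by apply: sum_pow2_neq0; case/orP: cA => /eqP ->.
have e1B : \sum_(i in B) (2 ^ i)%:R != 0 :> K.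
  by apply: sum_pow2_neq0; case/orP: cB => /eqP ->.
have sums_inj : \sum_(i in A) (2 ^ i)%:R = \sum_(i in B) (2 ^ i)%:R :> K -> A = B.
  by rewrite -!natr_sum => /eqP; rewrite eqr_nat => /eqP /subset_sum_pow2_inj.
rewrite /node; do 2!case: eqP => _; case=> //.
- by move/oppr_inj.
- by move=> _ /eqP; rewrite eq_sym oppr_eq0 invr_eq0 (negPf e1B).
- by move=> _ /eqP; rewrite oppr_eq0 invr_eq0 (negPf e1A).
- by move=> _ /oppr_inj /invr_inj.
Qed.

(** Applied to the embedding of the reals, this shows that the complex nodes are real. *)
Lemma map_node (K L : fieldType) (f : {rmorphism K -> L}) (d : nat) (A : {set 'I_d}) :
  node L A = (f (node K A).1, f (node K A).2).
Proof.
have fe1 : f (\sum_(i in A) (2 ^ i)%:R) = \sum_(i in A) (2 ^ i)%:R.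
  by rewrite rmorph_sum; apply: eq_bigr => i _; rewrite rmorph_nat.
have fp2 : f (\sum_(i in A) (2 ^ i)%:R ^+ 2) = \sum_(i in A) (2 ^ i)%:R ^+ 2.
  by rewrite rmorph_sum; apply: eq_bigr => i _; rewrite rmorphXn rmorph_nat.
rewrite /node; case: eqP => _ /=; first by rewrite rmorphN rmorph0 /= fe1.
by rewrite fmorph_div !rmorphN fmorph_div rmorphB rmorphXn fmorphV /= fe1 fp2 rmorph_nat.
Qed.

Lemma node_pair (K : fieldType) (d : nat) (j k : 'I_d) :
  j != k -> node K [set j; k] = (- ((2 ^ j)%:R + (2 ^ k)%:R), 0).
Proof. by move=> jk; rewrite /node cards2 jk big_setU1 ?big_set1 ?inE. Qed.

Lemma node_triple (K : numFieldType) (d : nat) (i j k : 'I_d) (a b c : K) :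
  i != j -> i != k -> j != k ->
  a = (2 ^ i)%:R -> b = (2 ^ j)%:R -> c = (2 ^ k)%:R ->
  node K [set i; j; k] =
    (- (a * b + a * c + b * c) / (a + b + c), - (a + b + c)^-1).
Proof.
move=> ij ik jk -> -> ->; rewrite /node -setUA.
have iN : i \notin [set j; k] by rewrite !inE negb_or ij.
have jN : j \notin [set k] by rewrite inE.
rewrite cardsU1 iN cards2 jk /= !(big_setU1 _ iN) !(big_setU1 _ jN) !big_set1 /=.
rewrite addrA; congr (_ / _, _); congr (- _).
by field.
Qed.

(** The common combinatorial form of the corank and repeated-eigenvalue criteria: three of the
    [d + 1] affine forms vanish. *)
Definition net_coincidence (K : pzRingType) (d : nat) (x y : K) : Prop :=
  exists l (j k : 'I_d), [/\ j != k, net_diag x y (2 ^ j)%:R = l,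
    net_diag x y (2 ^ k)%:R = l &
    y = 0 \/ exists i : 'I_d, [/\ i != j, i != k & net_diag x y (2 ^ i)%:R = l]].

Lemma net_coincidence_node (K : numFieldType) (d : nat) (A : {set 'I_d}) :
  A \in pairs_and_triples d -> net_coincidence d (node K A).1 (node K A).2.
Proof.
rewrite inE => /orP[/cards2P[j [k [jk ->]]]|].
  (* By Vieta, [- l] is the constant term of [(t - t_j) (t - t_k)]. *)
  rewrite node_pair //=; exists (- ((2 ^ j)%:R * (2 ^ k)%:R)), j, k.
  by split=> //; [rewrite /net_diag; ring | rewrite /net_diag; ring | left].
move=> /eqP cA.
have : (0 < #|A|)%N by rewrite cA.
rewrite card_gt0 => /set0Pn[i iA].
have : #|A :\ i| == 2 by have := cardsD1 i A; rewrite iA cA add1n => -[<-].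
case/cards2P => j [k [jk Ai]].
have EA : A = [set i; j; k] by rewrite -setUA -Ai setD1K.
have iN : i \notin [set j; k] by rewrite -Ai !inE eqxx.
have [ij ik] : i != j /\ i != k by apply/andP; rewrite !inE negb_or in iN.
have e1 : \sum_(i in A) (2 ^ i)%:R != 0 :> K by apply: sum_pow2_neq0; rewrite cA.
rewrite {}EA in e1 *; rewrite (node_triple ij ik jk erefl erefl erefl) /=.
move: e1; rewrite -setUA (big_setU1 _ iN) big_setU1 ?inE // big_set1 /= addrA.
set a := _%:R; set b := _%:R; set c := _%:R => e1.
(* By Vieta for [y t^3 + t^2 + x t - l], [l = y a b c] with [y = - 1 / (a + b + c)]. *)
exists (- (a * b * c) / (a + b + c)), j, k; rewrite -/b -/c /net_diag.
by split=> //; [field | field | right; exists i; split=> //; field].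
Qed.

(** First divided differences of [net_diag] eliminate [l], and a second one eliminates [x], which
    leaves an equation for [y] alone. *)
Lemma node_of_net_coincidence (K : numFieldType) (d : nat) (x y : K) :
  net_coincidence d x y -> exists2 A, A \in pairs_and_triples d & (x, y) = node K A.
Proof.
have pow_neq (i j : 'I_d) : i != j -> (2 ^ i)%:R - (2 ^ j)%:R != 0 :> K.
  by rewrite subr_eq0 eqr_nat eqn_exp2l.
case=> l [j [k [jk mj mk H]]].
set b : K := (2 ^ j)%:R in mj; set c : K := (2 ^ k)%:R in mk.
have bc0 : b - c != 0 by apply: pow_neq.
have Ejk : b + c + x + y * (b ^+ 2 + b * c + c ^+ 2) = 0.
  apply: (mulfI bc0); rewrite mulr0; apply: etrans (_ : net_diag x y b - net_diag x y c = 0).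
    by rewrite /net_diag; ring.
  by rewrite mj mk subrr.
have [y0|y0] := eqVneq y 0.
  exists [set j; k]; first by rewrite inE cards2 jk.
  rewrite node_pair // y0; congr pair; apply/eqP; rewrite -addr_eq0 -/b -/c.
  by move: Ejk; rewrite y0 mul0r addr0 addrC => ->.
case: H => [/eqP|[i [ij ik mi]]]; first by rewrite (negPf y0).
set a : K := (2 ^ i)%:R in mi.
have ac0 : a - c != 0 by apply: pow_neq.
have ab0 : a - b != 0 by apply: pow_neq.
have Eik : a + c + x + y * (a ^+ 2 + a * c + c ^+ 2) = 0.
  apply: (mulfI ac0); rewrite mulr0; apply: etrans (_ : net_diag x y a - net_diag x y c = 0).
    by rewrite /net_diag; ring.
  by rewrite mi mk subrr.
(* The difference of [Eik] and [Ejk], divided by [a - b]. *)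
have Ey : 1 + y * (a + b + c) = 0.
  apply: (mulfI ab0); rewrite mulr0 -(subrr 0) -{1}Eik -Ejk; ring.
have e1 : a + b + c != 0.
  by apply: contra_eq_neq Ey => ->; rewrite mulr0 addr0 oner_eq0.
have {Ey}Ey : y = - (a + b + c)^-1.
  by apply: (mulIf e1); rewrite mulNr mulVf //; apply/eqP; rewrite -addr_eq0 addrC Ey.
exists [set i; j; k].
  have iN : i \notin [set j; k] by rewrite !inE negb_or ij.
  by rewrite inE -setUA cardsU1 iN cards2 jk orbT.
rewrite (node_triple ij ik jk (a := a) (b := b) (c := c)) // -Ey; congr pair.
have -> : x = - (b + c) - y * (b ^+ 2 + b * c + c ^+ 2).
  by apply/eqP; rewrite -subr_eq0 -Ejk; apply/eqP; ring.
by rewrite Ey; field.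
Qed.

(** * Critical matrices in the net *)

Lemma critical_net (R : realType) (d : nat) (x y : R[i]) :
  critical_double_eigenvalue (net d.+1 x y) -> net_coincidence d.+1 x y.
Proof.
case=> _ cl; have : ~~ row_free (powers_mx (net d.+1 x y) d.+1).
  apply: powers_mx_zariski_closure cl => _ [A [symA repA ->]].
  rewrite -map_powers_mx /row_free mxrank_map.
  exact: powers_mx_sym_repeated.
by case/eigenvalue_corank2 => l /diag_plus_J_corank2 [j [k H]]; exists l, j, k.
Qed.

(** At a real coincidence the net is itself a real symmetric matrix with a repeated eigenvalue, thus
    a point of the set whose closure is taken. *)
Lemma critical_net_real (R : realType) (d : nat) (x y : R) :
  net_coincidence d x y ->
  critical_double_eigenvalue (net d (real_complex R x) (real_complex R y)).
Proof.
case=> l [j [k [jk mj mk H]]]; split; first exact: tr_net.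
move=> p; apply; exists (net d x y).
by split; [exact: tr_net | exact: diag_plus_J_repeated mj mk H | rewrite map_net].
Qed.

Theorem corollary15 (R : realType) (d : nat) (hd : (1 <= d)%N) :
  exists C0 C1 C2 : 'M[R]_d,
    [/\ C0^T = C0, C1^T = C1, C2^T = C2 &
      exists s : seq (R[i] * R[i]),
        [/\ uniq s,
            size s = 'C(d.+1, 3),
            forall x y : R[i],
              (x, y) \in s <->
              critical_double_eigenvalue
                (map_mx (real_complex R) C0 + x *: map_mx (real_complex R) C1
                 + y *: map_mx (real_complex R) C2)
          & forall x y : R[i], (x, y) \in s ->
              x \is Num.real /\ y \is Num.real]].
Proof.
case: d hd => // d _.
(* The net is sorted by its parameters: squares give the constant term, first powers the coefficient
   of [x], cubes and the all-ones matrix that of [y]. *)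
pose t (K : pzRingType) (e : nat) := \row_(i < d.+1) ((2 ^ i)%:R : K) ^+ e.
pose C2 (K : pzRingType) : 'M[K]_d.+1 := diag_mx (t K 3) + const_mx 1.
have netE (K : pzRingType) (x y : K) :
    net d.+1 x y = diag_mx (t K 2) + x *: diag_mx (t K 1) + y *: C2 K.
  rewrite /C2 scalerDr addrA -!linearZ /= -!linearD /=; congr (diag_mx _ + _).
  by apply/rowP => i; rewrite !mxE.
have map_diag e : map_mx (real_complex R) (diag_mx (t R e)) = diag_mx (t R[i] e).
  rewrite map_diag_mx; congr diag_mx; apply/rowP => i.
  by rewrite !mxE rmorphXn rmorph_nat.
exists (diag_mx (t R 2)), (diag_mx (t R 1)), (C2 R); split.
- exact: tr_diag_mx.
- exact: tr_diag_mx.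
- by rewrite linearD /= tr_diag_mx trmx_const.
have map_C2 : map_mx (real_complex R) (C2 R) = C2 R[i].
  by rewrite map_mxD map_diag; congr (_ + _); apply/matrixP => i j; rewrite !mxE.
rewrite !map_diag map_C2.
exists [seq node R[i] A | A <- enum (pairs_and_triples d.+1)]; split.
- rewrite map_inj_in_uniq ?enum_uniq // => A B; rewrite !mem_enum.
  exact: node_inj.
- by rewrite size_map -cardE card_pairs_and_triples.
- move=> x y; rewrite -netE; split.
    (* The coincidence is taken over the reals, since every complex node is the image of a real
       one. *)
    case/mapP => A; rewrite mem_enum => /(@net_coincidence_node R) cA.
    by rewrite (map_node (real_complex R)) => -[-> ->]; exact: critical_net_real.
  case/critical_net/node_of_net_coincidence => A A_in ->.
  by apply/mapP; exists A; rewrite ?mem_enum.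
move=> x y /mapP[A _]; rewrite (map_node (real_complex R)) => -[-> ->].
by split; rewrite complex_real eqxx.
Qed.
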